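(* Let $A \in \mathcal M_d(\mathbb R)$, let $\tau$ be a delay function such that $\inf_{s \in [0, t]} \tau(s) > 0$ for every $t \geq 0$, and let $h$ be its associated largest delay function. Assume that, for every solution $x\colon \lvert -h(0), +\infty) \to \mathbb R^d$ of $$x(t) = A x(t - \tau(t)), \qquad t \geq 0,$$ with bounded initial condition, we have $x(t) \to 0$ as $t \to +\infty$. Then $\rho(A) < 1$. If, in addition, $A$ is not nilpotent, then $\lim_{t \to +\infty} (t - \tau(t)) = +\infty$.
   Context: $\mathbb R_+ = [0, +\infty)$, $\mathbb R_+^\ast = (0, +\infty)$; $\mathcal M_d(\mathbb R)$ is the set of real $d \times d$ matrices, $d$ a positive integer, and $\rho(A)$ is the spectral radius of $A$. For $a \leq b$ in $\mathbb R \cup \{\pm\infty\}$, $\lvert a, b)$ denotes $[a, b)$ if $a > -\infty$ and $(a, b)$ if $a = -\infty$. A \emph{delay function} is any function $\tau\colon \mathbb R_+ \to \mathbb R_+^\ast$. Its \emph{largest delay function} is $h\colon \mathbb R_+ \to \mathbb R_+^\ast \cup \{+\infty\}$, $h(t) = t - \inf_{s \in [t, +\infty)} (s - \tau(s))$. A \emph{solution} is a function $x\colon \lvert -h(0), +\infty) \to \mathbb R^d$ such that $x(t) = A x(t - \tau(t))$ for every $t \in \mathbb R_+$; its \emph{initial condition} is its restriction to $\lvert -h(0), 0)$. *)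

(* Defs.v *)
From mathcomp Require Export all_boot all_order all_algebra.
From mathcomp Require Export all_classical all_reals all_analysis.
From mathcomp Require Export complex.
Export Order.TTheory GRing.Theory Num.Theory.
Export numFieldNormedType.Exports.

Set Implicit Arguments.
Unset Strict Implicit.
Unset Printing Implicit Defensive.

Local Open Scope classical_set_scope.
Local Open Scope ring_scope.

(* The set of eigenvalues is finite, and nonempty when d > 0, so that for d > 0
   the supremum is a maximum. *)
Definition spectral_radius (R : realType) (d : nat) (A : 'M[R]_d) : R :=
  sup [set Normc.normc z | z in
        [set z : R[i] | eigenvalue (map_mx (real_complex R) A) z]].

Definition nilpotent_mx (R : realType) (d : nat) (A : 'M[R]_d) : Prop :=
  exists k : nat, A ^+ k = 0.

(* Since s is real, this is [a, b[ for a finite and ]-oo, b[ for a = -oo. *)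
Definition closed_left_itv (R : realType) (a b : \bar R) : set R :=
  [set s : R | (a <= s%:E)%E /\ (s%:E < b)%E].

(* Functions on [0, +oo[ or on [- h 0, +oo[ are represented by functions on the
   whole of R, whose values outside that interval are never used. *)
Definition delay_function (R : realType) (tau : R -> R) : Prop :=
  forall t : R, 0 <= t -> 0 < tau t.

(* The infimum is at most t - tau t, hence it is not +oo; largest_delay tau t
   is +oo exactly when the infimum is -oo. *)
Definition largest_delay (R : realType) (tau : R -> R) (t : R) : \bar R :=
  (t%:E - ereal_inf [set (s - tau s)%:E | s in `[t, +oo[])%E.

(* For t >= 0, t - tau t lies in [- h 0, +oo[, so that values of x outside this
   domain play no role. *)
Definition is_solution (R : realType) (d : nat) (A : 'M[R]_d) (tau : R -> R)
    (x : R -> 'cV[R]_d) : Prop :=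
  forall t : R, 0 <= t -> x t = A *m x (t - tau t).

Definition initial_domain (R : realType) (tau : R -> R) : set R :=
  closed_left_itv (- largest_delay tau 0)%E 0%E.

Definition bounded_initial_condition (R : realType) (d : nat) (tau : R -> R)
    (x : R -> 'cV[R]_d) : Prop :=
  [bounded x s | s in initial_domain tau].

(* Main.v *)
(** Let [k t] be the number of times the map [t |-> t - tau t] must be iterated
    from [t] to reach the negative half-line; it is finite, and bounded on each
    half-line [t <= M], because [tau] is bounded away from [0] on bounded
    intervals.  For every vector [v], the function [x t = A^(k t) v] is a
    solution with constant initial condition, hence tends to [0].

    If [A] had an eigenvalue [z] of modulus at least [1] with left eigenvector
    [w], then [|w x(t)| = |z|^(k t) |w v|] would stay above [|w v|], and [v] can
    be chosen with [w v <> 0].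

    If [A] is not nilpotent and [k <= K] on [t <= M], choose [v] with
    [A^(K+1) v <> 0].  The vectors [A^j v], [j <= K+1], are bounded away from
    [0], so [k t > K + 1] for large [t]; since [k t = k (t - tau t) + 1] this
    forces [t - tau t > M]. *)
Require Import Defs.

Set Implicit Arguments.
Unset Strict Implicit.
Unset Printing Implicit Defensive.

Local Open Scope classical_set_scope.
Local Open Scope ring_scope.

(** Finiteness keeps the inequality strict. The assumption [0 < c] covers empty [S], whose [sup] is
    [0] by convention. *)
Lemma sup_finite_lt (R : realType) (S : set R) (c : R) :
  0 < c -> finite_set S -> (forall y, S y -> y < c) -> sup S < c.
Proof.
move=> c0 /finite_seqP[s ->] sc.
have [r [rc rs]] : exists r, r < c /\ forall y, y \in s -> y <= r.
  elim: s sc => [|a s IH] sc; first by exists 0.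
  have [y ys|r [rc rs]] := IH; first by apply: sc => /=; rewrite inE ys orbT.
  exists (Num.max a r); rewrite gt_max rc sc /= ?mem_head//; split=> // y.
  rewrite inE le_max => /predU1P[->|/rs ->]; first by rewrite lexx.
  by rewrite orbT.
have [->|/set0P s0] := eqVneq [set` s] set0; first by rewrite sup0.
exact: le_lt_trans (ge_sup s0 rs) rc.
Qed.

Lemma finite_eigenvalues (F : fieldType) (n : nat) (B : 'M[F]_n) :
  finite_set [set z | eigenvalue B z].
Proof.
apply: contrapT => /(infinite_set_fset (size (char_poly B)))[s sB].
apply/negP; rewrite -ltnNge max_poly_roots ?finmap.fset_uniq//.
  exact/monic_neq0/char_poly_monic.
by apply/allP => z zs; rewrite -eigenvalue_root_char; exact: sB.
Qed.

Lemma spectral_radius_lt (R : realType) (d : nat) (A : 'M[R]_d) (c : R) :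
  0 < c ->
  (forall z, eigenvalue (map_mx (real_complex R) A) z -> Normc.normc z < c) ->
  spectral_radius A < c.
Proof.
move=> c0 Hc; apply: sup_finite_lt => // [|_ [z /Hc zc <-//]].
exact/finite_image/finite_eigenvalues.
Qed.

Section DelayStepCount.
Context (R : realType) (tau : R -> R).
Hypothesis tau_inf : forall t, 0 <= t -> 0 < inf [set tau s | s in `[0, t]].
Hypothesis tau_gt0 : delay_function tau.

Let back (t : R) := t - tau t.

(** From a point of [[0, M]] each step descends by at least the infimum [e] of [tau] there, so the
    orbit stays below [M] until it turns negative, and any [n] with [M < n * e] bounds the number of
    steps. *)
Lemma iter_back_lt0 (M : R) :
  exists K, forall s, s <= M -> exists2 n, (n <= K)%N & iter n back s < 0.
Proof.
have [M0|M0] := ltP M 0.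
  by exists 0%N => s sM; exists 0%N => //=; exact: le_lt_trans sM M0.
set e := inf [set tau s | s in `[0, M]].
have e0 : 0 < e := tau_inf M0.
have etau s : 0 <= s <= M -> e <= tau s.
  move=> sM; apply: ge_inf; last by exists s => //=; rewrite in_itv.
  by exists 0 => _ [u /= + <-]; rewrite in_itv/= => /andP[/tau_gt0/ltW].
have bound n s : s <= M -> s < n%:R * e ->
    exists2 m, (m <= n)%N & iter m back s < 0.
  elim: n s => [|n IH] s sM; first by rewrite mul0r; exists 0%N.
  have [s0|s0 sn] := ltP s 0; first by exists 0%N.
  have es : e <= tau s by apply: etau; rewrite s0.
  have [||m mn mlt0] := IH (back s).
  - by rewrite /back lerBlDr (le_trans sM)// lerDl (le_trans (ltW e0)).
  - by rewrite /back ltrBlDr (lt_le_trans sn)// mulrSr mulrDl mul1r lerD2l.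
  - by exists m.+1; rewrite // iterSr.
exists (Num.truncn (M / e)).+1 => s sM; apply: bound => //.
rewrite -ltr_pdivrMr// (le_lt_trans _ (truncnS_gt _))//.
by rewrite ler_pM2r ?invr_gt0.
Qed.

Lemma delay_step_count : exists k : R -> nat,
  [/\ forall t, t < 0 -> k t = 0%N,
      forall t, 0 <= t -> k t = (k (t - tau t)).+1 &
      forall M, exists K, forall s, s <= M -> (k s <= K)%N].
Proof.
have ex t : exists n, iter n back t < 0.
  by have [K /(_ t (lexx t))[n _ nlt0]] := iter_back_lt0 t; exists n.
(* The first entrance is counted: [tau] is unconstrained on negative arguments, so later iterates
   may become nonnegative again. *)
exists (fun t => ex_minn (ex t)); split=> [t t0|t t0|M].
- by case: ex_minnP => -[//|m] _ /(_ 0%N t0).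
- case: ex_minnP => -[|m mlt0 mmin]; first by rewrite /= ltNge t0.
  case: ex_minnP => n nlt0 nmin; apply/eqP; rewrite eqSS eqn_leq.
  by rewrite -ltnS mmin ?iterSr//= nmin// -[t - _]/(back t) -iterSr.
- have [K KP] := iter_back_lt0 M; exists K => s /KP[n nK nlt0].
  by case: ex_minnP => m _ /(_ n nlt0)/leq_trans; apply.
Qed.

End DelayStepCount.

Section PowerSolution.
Context (R : realType) (d : nat) (A : 'M[R]_d) (tau : R -> R) (k : R -> nat).
Hypothesis k0 : forall t, t < 0 -> k t = 0%N.
Hypothesis kS : forall t, 0 <= t -> k t = (k (t - tau t)).+1.

Lemma power_solution (v : 'cV[R]_d) :
  is_solution A tau (fun t => A ^+ k t *m v).
Proof. by move=> t /kS ->; rewrite exprS mulmxA. Qed.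

Lemma power_solution_bounded (v : 'cV[R]_d) :
  bounded_initial_condition tau (fun t => A ^+ k t *m v).
Proof.
exists `|v|; split=> [|M /ltW vM s [_]]; first exact: normr_real.
by rewrite lte_fin => s0 /=; rewrite k0// expr0 mul1mx.
Qed.

End PowerSolution.

Lemma normc_real (R : rcfType) (a : R) : `|a%:C%C| = `|a|%:C%C.
Proof. by rewrite normc_def/= expr0n/= addr0 sqrtr_sqr. Qed.

Lemma normc_mulmx_map_le (R : realType) (d : nat) (w : 'rV[R[i]]_d)
    (x : 'cV[R]_d) :
  `|(w *m map_mx (real_complex R) x) 0 0| <=
  (\sum_j `|w 0 j|) * (`|x|)%:C%C.
Proof.
rewrite mxE (le_trans (ler_norm_sum _ _ _))// mulr_suml ler_sum// => j _.
rewrite normrM ler_wpM2l// mxE normc_real lecR.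
rewrite [leRHS]/Num.Def.normr/= mx_normrE.
exact: (le_bigmax _ (fun ij : 'I_d * 'I_1 => `|x ij.1 ij.2|) (j, 0)).
Qed.

Lemma eigen_power_not_cvg0 (R : realType) (d : nat) (A : 'M[R]_d)
    (k : R -> nat) (z : R[i]) :
  eigenvalue (map_mx (real_complex R) A) z -> 1 <= Normc.normc z ->
  exists v : 'cV[R]_d, ~ (A ^+ k t *m v @[t --> +oo] --> (0 : 'cV[R]_d)).
Proof.
(* [w] may be complex, but [v] must be real: a basis vector at a nonzero entry of [w] gives
   [w v = w 0 i]. *)
move=> /eigenvalueP[w wA /rV0Pn[i wi]] z1; pose v : 'cV[R]_d := delta_mx i 0.
exists v => cvg0.
set B := map_mx _ A in wA.
have wAk n : w *m B ^+ n = z ^+ n *: w.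
  elim: n => [|n IH]; first by rewrite mulmx1 scale1r.
  by rewrite exprS mulmxA wA -scalemxAl IH scalerA -exprS.
have wAv n : (w *m map_mx (real_complex R) (A ^+ n *m v)) 0 0 =
    z ^+ n * w 0 i.
  by rewrite map_mxM /v map_delta_mx mulmxA rmorphXn/= wAk -colE !mxE.
set C := \sum_j Normc.normc (w 0 j).
have C0 : 0 <= C by rewrite sumr_ge0// => j _;
  case: (w 0 j) => a b; exact: sqrtr_ge0.
have wi0 : 0 < Normc.normc (w 0 i).
  by rewrite -ltcR -[X in _ < X]/(`|w 0 i|) normr_gt0.
(* Below this threshold [|w x| <= C |x| <= (C + 1) |x| < |w 0 i|]; adding [1] makes the denominator
   positive at once. *)
have e0 : 0 < Normc.normc (w 0 i) / (C + 1) by rewrite divr_gt0// ltr_wpDl.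
have /filter_ex[t] : \forall t \near +oo,
    `|A ^+ k t *m v| < Normc.normc (w 0 i) / (C + 1).
  exact: cvgr0_norm_lt cvg0 _ e0.
rewrite ltr_pdivlMr ?ltr_wpDl// => xt.
have := normc_mulmx_map_le w (A ^+ k t *m v).
have -> : \sum_j `|w 0 j| = C%:C%C by rewrite rmorph_sum.
rewrite wAv -rmorphM normrM normrX => Cx.
have : (Normc.normc (w 0 i))%:C%C <= (C * `|A ^+ k t *m v|)%:C%C.
  apply: le_trans Cx; apply: ler_peMl; first exact: (normr_ge0 (w 0 i)).
  by apply: exprn_ege1; rewrite -[leLHS]/(1%:C%C)
    -[leRHS]/((Normc.normc z)%:C%C) lecR.
rewrite lecR leNgt (le_lt_trans _ xt)// mulrC.
by rewrite ler_wpM2l// lerDl.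
Qed.

(** An orbit that reaches [0] stays there, so all earlier vectors are nonzero too, and the least of
    finitely many positive norms serves as [e]. *)
Lemma power_orbit_away0 (R : realType) (d : nat) (A : 'M[R]_d) (v : 'cV[R]_d)
    (K : nat) :
  A ^+ K *m v != 0 ->
  exists2 e, 0 < e & forall j, (j <= K)%N -> e <= `|A ^+ j *m v|.
Proof.
move=> AKv.
have Av j : (j <= K)%N -> A ^+ j *m v != 0.
  move=> jK; apply: contraNneq AKv => Ajv.
  by rewrite -(subnK jK) exprD -[_ * _]/(_ *m _) -mulmxA Ajv mulmx0.
elim: K {AKv} Av => [|K IH] Av.
  exists `|v| => [|j]; first by have := Av 0%N isT; rewrite mul1mx normr_gt0.
  by rewrite leqn0 => /eqP->; rewrite mul1mx.
have [j jK|e e0 He] := IH; first exact/Av/leqW.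
exists (Num.min e `|A ^+ K.+1 *m v|) => [|j].
  by rewrite lt_min e0 normr_gt0 Av.
rewrite leq_eqVlt => /predU1P[->|/He jK]; first by rewrite ge_min lexx orbT.
by rewrite ge_min jK.
Qed.

Lemma mulmx_cV_neq0 (F : pzRingType) (m n : nat) (B : 'M[F]_(m, n)) :
  B != 0 -> exists v : 'cV[F]_n, B *m v != 0.
Proof.
move=> /eqP B0; apply: contrapT => Bv; apply: B0; apply/matrixP => i j.
rewrite mxE; have [|Bj] := eqVneq (B *m delta_mx j 0 : 'cV_m) 0.
  by rewrite -colE => /matrixP/(_ i 0); rewrite !mxE.
by case: Bv; exists (delta_mx j 0).
Qed.

Theorem proposition5p5 (R : realType) (d : nat) (hd : (0 < d)%N)
    (A : 'M[R]_d) (tau : R -> R)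
    (htau : delay_function tau)
    (hinf : forall t : R, 0 <= t -> 0 < inf [set tau s | s in `[0, t]])
    (hconv : forall x : R -> 'cV[R]_d,
        is_solution A tau x ->
        bounded_initial_condition tau x ->
        x t @[t --> +oo] --> (0 : 'cV[R]_d)) :
  spectral_radius A < 1 /\
  (~ nilpotent_mx A -> t - tau t @[t --> +oo] --> +oo).
Proof.
have [k [k0 kS kbnd]] := delay_step_count hinf htau.
have cvg0 v : A ^+ k t *m v @[t --> +oo] --> (0 : 'cV[R]_d).
  exact: hconv (power_solution A kS v) (power_solution_bounded A tau k0 v).
split=> [|Anil].
  apply: spectral_radius_lt => // z zA; rewrite ltNge; apply/negP => z1.
  by have [v] := eigen_power_not_cvg0 k zA z1; apply.
apply/cvgryPge => M; have [K kK] := kbnd M.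
have /mulmx_cV_neq0[v] : A ^+ K.+1 != 0.
  by apply/eqP => AK; apply: Anil; exists K.+1.
move=> /power_orbit_away0[e e0 He].
have : \forall t \near +oo, `|A ^+ k t *m v| < e.
  exact: cvgr0_norm_lt (cvg0 v) _ e0.
apply: filter_app; near=> t => xt.
have t0 : 0 <= t by near: t; exact: nbhs_pinfty_ge.
(* If [t - tau t] were at most [M], then [k t] would be at most [K + 1], one step beyond the bound
   [K], where the orbit of [v] has norm at least [e]. *)
rewrite leNgt; apply/negP => /ltW/kK kt.
by have := He (k t); rewrite kS// ltnS kt leNgt -kS// xt => /(_ isT).
Unshelve. all: by end_near. Qed.
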